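(* Let $\Gamma\subseteq\mathfrak{S}$ be a set of permutations, each of length at least $2$. Then \[ \frac{1}{1-t}+\frac{1+t}{2(1-t)}\sum_{n=1}^{\infty}P_{\Gamma,n}^{\mathrm{ipk}}(s,u)z^{n}=\sum_{n=0}^{\infty}\left(\frac{2tx}{(1-t)^{2}}+\frac{1+t}{2(1-t)}\sum_{k=2}^{\infty}R_{\Gamma,k}^{\mathrm{ipk}}(s-1,u)z^{k}\right)^{*\langle n\rangle} \] where $u=4t/(1+t)^{2}$ and $z=(1+t)x/(1-t)$.
   Context: $\mathfrak{S}_n$ is the set of permutations of $[n]$ in one-line notation, $\mathfrak{S}=\bigsqcup_n\mathfrak{S}_n$. $\operatorname{std}$ of a sequence of distinct integers replaces its letters by $1,2,\dots$ in order of size. For $\pi\in\mathfrak{S}_n$, $\sigma\in\mathfrak{S}_m$, an occurrence of $\sigma$ in $\pi$ is an $i\in[n-m+1]$ with $\operatorname{std}(\pi_i\cdots\pi_{i+m-1})=\sigma$; a marked occurrence of a pattern in $\Gamma$ is a pair $(i,\sigma)$, $\sigma\in\Gamma$, $i$ an occurrence of $\sigma$; $\operatorname{occ}_\Gamma(\pi)$ is the number of such pairs. A $\Gamma$-cluster on $\pi\in\mathfrak{S}_n$ is a nonempty set $c$ of marked occurrences such that for every $j\in[n-1]$ some $(i,\sigma)\in c$, $\sigma\in\mathfrak{S}_m$, has $i\le j<i+m-1$; $C_{\Gamma,\pi}$ is the set of these, $\operatorname{mk}_\Gamma(c)=|c|$. A peak of $\pi\in\mathfrak{S}_n$ is $i\in\{2,\dots,n-1\}$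 with $\pi_{i-1}<\pi_i>\pi_{i+1}$; $\operatorname{pk}(\pi)$ is the number of peaks and $\operatorname{ipk}(\pi)=\operatorname{pk}(\pi^{-1})$. $P_{\Gamma,n}^{\mathrm{ipk}}(s,t)=\sum_{\pi\in\mathfrak{S}_n}s^{\operatorname{occ}_\Gamma(\pi)}t^{\operatorname{ipk}(\pi)+1}$ for $n\ge1$; $R_{\Gamma,k}^{\mathrm{ipk}}(s,t)=\sum_{\pi\in\mathfrak{S}_k}t^{\operatorname{ipk}(\pi)+1}\sum_{c\in C_{\Gamma,\pi}}s^{\operatorname{mk}_\Gamma(c)}$. The identity is in formal power series in $s,t,x$ whose multiplication is ordinary in $s,x$ and the Hadamard product in $t$: $(\sum_n a_nt^n)*(\sum_n b_nt^n)=\sum_n a_nb_nt^n$; $f^{*\langle n\rangle}$ is the $n$-fold Hadamard product of $f$ (as a power series in $t$, after the substitutions for $u,z$), $f^{*\langle0\rangle}=1/(1-t)$. Other expressions use ordinary multiplication. *)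

(* Defs.v *)
From HB Require Import structures.
From mathcomp Require Import all_boot all_order all_algebra all_fingroup.
From mathcomp Require Import all_classical.

Set Implicit Arguments.
Unset Strict Implicit.
Unset Printing Implicit Defensive.

Import GRing.Theory.
Local Open Scope ring_scope.

Record fps (R : Type) := FPS { fps_coef :> nat -> R }.

Notation "{ 'fps' R }" := (fps R) (at level 0, R at level 2,
  format "{ 'fps'  R }") : type_scope.

Lemma fpsP (R : Type) (f g : {fps R}) : (forall n, f n = g n) -> f = g.
Proof. by case: f g => [f] [g] /= fg; congr FPS; apply: funext. Qed.

HB.instance Definition _ (R : Type) := gen_eqMixin {fps R}.
HB.instance Definition _ (R : Type) := gen_choiceMixin {fps R}.

Section Zmodule.
Variable R : zmodType.
Implicit Types f g h : {fps R}.

Definition fps0 : {fps R} := FPS (fun _ => 0).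
Definition fps_opp f : {fps R} := FPS (fun n => - f n).
Definition fps_add f g : {fps R} := FPS (fun n => f n + g n).

Lemma fps_addA : associative fps_add.
Proof. by move=> f g h; apply: fpsP => n; apply: addrA. Qed.
Lemma fps_addC : commutative fps_add.
Proof. by move=> f g; apply: fpsP => n; apply: addrC. Qed.
Lemma fps_add0 : left_id fps0 fps_add.
Proof. by move=> f; apply: fpsP => n; apply: add0r. Qed.
Lemma fps_addN : left_inverse fps0 fps_opp fps_add.
Proof. by move=> f; apply: fpsP => n; apply: addNr. Qed.

HB.instance Definition _ :=
  GRing.isZmodule.Build {fps R} fps_addA fps_addC fps_add0 fps_addN.

Lemma fps0E n : (0 : {fps R}) n = 0. Proof. by []. Qed.
Lemma fpsDE f g n : (f + g) n = f n + g n. Proof. by []. Qed.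
Lemma fpsNE f n : (- f) n = - f n. Proof. by []. Qed.

End Zmodule.

Section Ring.
Variable R : comNzRingType.
Implicit Types f g h : {fps R}.

Definition fpsC (a : R) : {fps R} := FPS (fun n => if n == 0%N then a else 0).
Definition fpsX : {fps R} := FPS (fun n => (n == 1%N)%:R).
Definition fps_mul f g : {fps R} :=
  FPS (fun n => \sum_(i < n.+1) f i * g (n - i)%N).

Definition fps_trunc N f : {poly R} := \poly_(i < N) f i.

Lemma fps_mul_poly N f g (p q : {poly R}) :
    (forall i, (i < N)%N -> f i = p`_i) ->
    (forall i, (i < N)%N -> g i = q`_i) ->
  forall i, (i < N)%N -> fps_mul f g i = (p * q)`_i.
Proof.
move=> fp gq i ltiN; rewrite coefM; apply: eq_bigr => j _ /=.
rewrite fp ?gq //; first exact: leq_ltn_trans (leq_subr _ _) ltiN.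
by apply: leq_ltn_trans ltiN; rewrite -ltnS.
Qed.

Lemma fps_truncE N f i : (i < N)%N -> f i = (fps_trunc N f)`_i.
Proof. by rewrite coef_poly => ->. Qed.

Lemma fps_mulA : associative fps_mul.
Proof.
move=> f g h; apply: fpsP => n.
pose T := @fps_truncE n.+1.
rewrite (fps_mul_poly (T f) (fps_mul_poly (T g) (T h))) //.
by rewrite (fps_mul_poly (fps_mul_poly (T f) (T g)) (T h)) // mulrA.
Qed.

Lemma fps_mulC : commutative fps_mul.
Proof.
move=> f g; apply: fpsP => n; pose T := @fps_truncE n.+1.
by rewrite (fps_mul_poly (T f) (T g)) // (fps_mul_poly (T g) (T f)) // mulrC.
Qed.

Lemma fps_mul1 : left_id (fpsC 1) fps_mul.
Proof.
move=> f; apply: fpsP => n /=; rewrite big_ord_recl /= mul1r subn0 big1 ?addr0 //.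
by move=> i _; rewrite mul0r.
Qed.

Lemma fps_mulDl : left_distributive fps_mul +%R.
Proof.
move=> f g h; apply: fpsP => n; rewrite fpsDE /= -big_split /=.
by apply: eq_bigr => i _; rewrite mulrDl.
Qed.

Lemma fps_one_neq0 : fpsC 1 != 0.
Proof.
by apply/eqP => /(congr1 (fun f : {fps R} => f 0%N)) /eqP; rewrite /= oner_eq0.
Qed.

HB.instance Definition _ := GRing.Zmodule_isComNzRing.Build {fps R}
  fps_mulA fps_mulC fps_mul1 fps_mulDl fps_one_neq0.

Lemma fpsME f g n : (f * g) n = \sum_(i < n.+1) f i * g (n - i)%N.
Proof. by []. Qed.
Lemma fps1E n : (1 : {fps R}) n = if n == 0%N then 1 else 0.
Proof. by []. Qed.

Lemma fpsM0 f g : (f * g) 0%N = f 0%N * g 0%N.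
Proof. by rewrite fpsME big_ord1. Qed.

End Ring.
Arguments fpsX {R}.

Section UnitRing.
Variable R : comUnitRingType.
Implicit Types f g h : {fps R}.

(* [fps_inv_seq f n] lists the first [n] coefficients of the inverse of [f]. *)
Fixpoint fps_inv_seq f n : seq R :=
  if n is n'.+1 then
    let r := fps_inv_seq f n' in
    rcons r ((f 0%N)^-1 *
      ((n' == 0%N)%:R - \sum_(i < n') f i.+1 * r`_(n' - i.+1)))
  else [::].

Definition fps_unit : {pred {fps R}} := fun f => f 0%N \is a GRing.unit.
Definition fps_inv f : {fps R} :=
  if f \in fps_unit then FPS (fun n => (fps_inv_seq f n.+1)`_n) else f.

Lemma size_fps_inv_seq f n : size (fps_inv_seq f n) = n.
Proof. by elim: n => //= n IHn; rewrite size_rcons IHn. Qed.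

Lemma nth_fps_inv_seq f n i :
  (i < n)%N -> (fps_inv_seq f n)`_i = (fps_inv_seq f i.+1)`_i.
Proof.
elim: n => // n IHn; rewrite ltnS leq_eqVlt => /orP[/eqP-> //|ltin].
by rewrite -IHn //= nth_rcons size_fps_inv_seq ltin.
Qed.

Lemma fps_mulVf : {in fps_unit, left_inverse 1 fps_inv *%R}.
Proof.
move=> f fU; rewrite mulrC; apply: fpsP => n.
rewrite fpsME /fps_inv fU big_ord_recl subn0.
rewrite [X in f _ * X]nth_rcons size_fps_inv_seq ltnn eqxx mulVKr //.
have -> : (1 : {fps R}) n = (n == 0%N)%:R by rewrite fps1E; case: eqP.
rewrite -addrA -[RHS]addr0; congr (_ + _); apply/eqP.
rewrite addrC subr_eq0; apply/eqP/eq_bigr => i _.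
have n_gt0 : (0 < n)%N := leq_ltn_trans (leq0n i) (ltn_ord i).
by rewrite [in RHS](@nth_fps_inv_seq f n) // ltn_subrL n_gt0.
Qed.

Lemma fps_unitPl f g : g * f = 1 -> f \in fps_unit.
Proof.
move/(congr1 (fun f : {fps R} => f 0%N)); rewrite fpsM0 => gf1.
by apply/unitrPr; exists (g 0%N); rewrite mulrC.
Qed.

Lemma fps_inv_out : {in [predC fps_unit], fps_inv =1 id}.
Proof. by move=> f; rewrite inE /= /fps_inv => /negPf->. Qed.

HB.instance Definition _ := GRing.ComNzRing_hasMulInverse.Build {fps R}
  fps_mulVf fps_unitPl fps_inv_out.

Lemma fps_unitE f : (f \is a GRing.unit) = (f 0%N \is a GRing.unit).
Proof. by []. Qed.

End UnitRing.

(* The sum of the [F n], [n >= a], taken coefficient by coefficient. It is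
   meaningful for families satisfying [fps_summable]; the finitely supported
   sum on the right is 0 when the support is infinite. *)
Definition fps_sum (R : zmodType) (a : nat) (F : nat -> {fps R}) : {fps R} :=
  FPS (fun i => \sum_(n \in [set n | (a <= n)%N]%classic) F n i).

Definition fps_summable (R : zmodType) (F : nat -> {fps R}) :=
  forall i, finite_set [set n | F n i != 0]%classic.

(* In [{fps {fps R}}] the outer variable is [x] and the inner one is [t]: the
   product is the Cauchy product in [x] and the Hadamard product in [t]. *)
Definition hadamard (R : comNzRingType) (f g : {fps {fps R}}) : {fps {fps R}} :=
  FPS (fun n => FPS (fun m => \sum_(i < n.+1) f i m * g (n - i)%N m)).

Definition hadamard_pow (R : comUnitRingType) (f : {fps {fps R}}) (n : nat) :
  {fps {fps R}} := iter n (hadamard f) (1 - fpsC fpsX)^-1.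

(* Permutations act on [{0, ..., n-1}]; words, positions and letters are
   numbered from 1. *)
Definition oneline (n : nat) (pi : 'S_n) : seq nat :=
  [seq (pi i : nat).+1 | i <- enum 'I_n].

Definition letter (n : nat) (pi : 'S_n) (i : nat) : nat :=
  nth 0%N (oneline pi) i.-1.

Definition std (w : seq nat) : seq nat :=
  [seq (index a (sort leq w)).+1 | a <- w].

Definition occurrence (n m : nat) (sigma : 'S_m) (pi : 'S_n) (i : nat) : bool :=
  (0 < i <= n.+1 - m)%N && (std (take m (drop i.-1 (oneline pi))) == oneline sigma).

(* A subset of the disjoint union of the ['S_m]. *)
Definition permset := forall m : nat, {set 'S_m}.

(* Pairs [(i, sigma)] that may be marked in a permutation of length [n]: the
   length [m] of [sigma] is at most [n], and then [i <= n + 1 - m <= n + 1]. *)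
Definition marking (n : nat) : finType :=
  {m : 'I_n.+1 & ('I_n.+2 * 'S_m)%type}.

Definition mk_len (n : nat) (p : marking n) : nat := tag p.
Definition mk_pos (n : nat) (p : marking n) : nat := (tagged p).1.
Definition mk_pat (n : nat) (p : marking n) : 'S_(mk_len p) := (tagged p).2.

Definition marked_occs (Gamma : permset) (n : nat) (pi : 'S_n) :
    {set marking n} :=
  [set p | (mk_pat p \in Gamma (mk_len p)) &&
           occurrence (mk_pat p) pi (mk_pos p)].

Definition occ (Gamma : permset) (n : nat) (pi : 'S_n) : nat :=
  #|marked_occs Gamma pi|.

Definition clusters (Gamma : permset) (n : nat) (pi : 'S_n) :
    {set {set marking n}} :=
  [set c : {set marking n} |
    [&& c \subset marked_occs Gamma pi, c != finset.set0 &
        [forall j : 'I_n, (0 < j)%N ==>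
          [exists p in c,
            (mk_pos p <= j)%N && (j < (mk_pos p + mk_len p).-1)%N]]]].

Definition mk (n : nat) (c : {set marking n}) : nat := #|c|.

Definition is_peak (n : nat) (pi : 'S_n) (i : nat) : bool :=
  (letter pi i.-1 < letter pi i)%N && (letter pi i.+1 < letter pi i)%N.

Definition pk (n : nat) (pi : 'S_n) : nat := count (is_peak pi) (index_iota 2 n).

Definition ipk (n : nat) (pi : 'S_n) : nat := pk (pi^-1)%g.

(* The polynomials in [s] and [t], as evaluated at elements of a commutative
   ring. *)
Definition Pipk (A : comNzRingType) (Gamma : permset) (n : nat) (s t : A) : A :=
  \sum_(pi : 'S_n) s ^+ occ Gamma pi * t ^+ (ipk pi).+1.

Definition Ripk (A : comNzRingType) (Gamma : permset) (k : nat) (s t : A) : A :=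
  \sum_(pi : 'S_k) t ^+ (ipk pi).+1 *
    \sum_(c in clusters Gamma pi) s ^+ mk c.

(* [rat[[s]][[t]][[x]]] *)
Notation series := {fps {fps {fps rat}}}.

Definition var_s : series := fpsC (fpsC fpsX).
Definition var_t : series := fpsC fpsX.
Definition var_x : series := fpsX.

Definition ser_u : series := 4%:R * var_t / (1 + var_t) ^+ 2.
Definition ser_z : series := (1 + var_t) * var_x / (1 - var_t).

Definition cluster_series (Gamma : permset) : series :=
  2%:R * var_t * var_x / (1 - var_t) ^+ 2
  + (1 + var_t) / (2%:R * (1 - var_t))
    * fps_sum 2 (fun k => Ripk Gamma k (var_s - 1) ser_u * ser_z ^+ k).

Lemma fps_coef0_nat (R : comNzRingType) n : (n%:R : {fps R}) 0%N = n%:R.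
Proof. by elim: n => // n IHn; rewrite -!natr1 fpsDE IHn. Qed.

(* The denominators are invertible and the infinite sums locally finite,
   so no default value of [^-1] or [fps_sum] is involved in the identity. *)
Lemma unit_1Dt : (1 + var_t : series) \is a GRing.unit.
Proof. by rewrite !fps_unitE !fpsDE /= addr0 unitr1. Qed.

Lemma unit_1Bt : (1 - var_t : series) \is a GRing.unit.
Proof. by rewrite !fps_unitE !(fpsDE, fpsNE) /= subr0 unitr1. Qed.

Lemma unit_2_1Bt : (2%:R * (1 - var_t) : series) \is a GRing.unit.
Proof. by rewrite unitrM unit_1Bt andbT !fps_unitE !fps_coef0_nat. Qed.

Definition fps_order_ge (R : zmodType) (a : nat) (f : {fps R}) :=
  forall i, (i < a)%N -> f i = 0.

Lemma fps_order_geM (R : comNzRingType) a b (f g : {fps R}) :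
  fps_order_ge a f -> fps_order_ge b g -> fps_order_ge (a + b) (f * g).
Proof.
move=> fa gb i ltiab; rewrite fpsME big1 // => j _.
have [/fa-> | leaj] := ltnP j a; first by rewrite mul0r.
rewrite gb ?mulr0 // ltn_subLR; last by rewrite -ltnS.
by apply: leq_trans ltiab _; rewrite leq_add2r.
Qed.

Lemma fps_order_ge0 (R : zmodType) (f : {fps R}) : fps_order_ge 0 f.
Proof. by []. Qed.

Lemma fps_order_geX (R : comNzRingType) (f : {fps R}) n :
  fps_order_ge 1 f -> fps_order_ge n (f ^+ n).
Proof.
move=> f1; elim: n => // n IHn.
by rewrite exprS -add1n; apply: fps_order_geM.
Qed.

Lemma fps_order_ge_sum (R : zmodType) a b (F : nat -> {fps R}) :
  (forall n, (a <= n)%N -> fps_order_ge b (F n)) ->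
  fps_order_ge b (fps_sum a F).
Proof. by move=> Fb i ltib /=; apply: fsbig1 => n /= /Fb; apply. Qed.

Lemma fps_summable_order (R : zmodType) (F : nat -> {fps R}) :
  (forall n, fps_order_ge n (F n)) -> fps_summable F.
Proof.
move=> Fn i; apply: (@sub_finite_set _ _ `I_i.+1); last exact: finite_II.
by move=> n /= nz; rewrite ltnS leqNgt; apply: contraNN nz => /Fn->.
Qed.

Lemma order_ser_z : fps_order_ge 1 ser_z.
Proof.
by case=> // _; rewrite !fpsM0 [var_x _]/= mulr0 mul0r.
Qed.

Lemma order_term (f : series) n : fps_order_ge n (f * ser_z ^+ n).
Proof.
by rewrite -[n in fps_order_ge n]add0n; apply: fps_order_geM => //;
   apply: fps_order_geX order_ser_z.
Qed.

Lemma summable_P Gamma :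
  fps_summable (fun n => Pipk Gamma n var_s ser_u * ser_z ^+ n).
Proof. by apply: fps_summable_order => n; apply: order_term. Qed.

Lemma summable_R Gamma :
  fps_summable (fun k => Ripk Gamma k (var_s - 1) ser_u * ser_z ^+ k).
Proof. by apply: fps_summable_order => n; apply: order_term. Qed.

Lemma order_cluster_series Gamma : fps_order_ge 1 (cluster_series Gamma).
Proof.
case=> // _; rewrite fpsDE !fpsM0 [var_x _]/= mulr0 mul0r add0r.
rewrite (@fps_order_ge_sum _ _ 1) ?mulr0 // => k le2k i lti1.
by apply: order_term; apply: leq_trans lti1 (ltnW le2k).
Qed.

Lemma order_hadamard_pow (R : comUnitRingType) (f : {fps {fps R}}) n :
  fps_order_ge 1 f -> fps_order_ge n (hadamard_pow f n).
Proof.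
move=> f1; elim: n => // n IHn i ltin.
apply: fpsP => m /=; rewrite big1 // => j _.
have [/f1-> | lt0j] := ltnP j 1; first by rewrite mul0r.
rewrite -/(hadamard_pow f n) IHn ?mulr0 // ltn_subLR; last by rewrite -ltnS.
by apply: leq_trans ltin _; rewrite -add1n leq_add2r.
Qed.

Lemma summable_hadamard_pow Gamma :
  fps_summable (hadamard_pow (cluster_series Gamma)).
Proof.
apply: fps_summable_order => n; apply: order_hadamard_pow.
exact: order_cluster_series.
Qed.

(* Main.v *)
Require Import Defs.
From HB Require Import structures.
From mathcomp Require Import all_classical.
From mathcomp Require Import all_boot all_order all_algebra all_fingroup.
From mathcomp Require Import zify ring.
Set Implicit Arguments.
Unset Strict Implicit.
Unset Printing Implicit Defensive.
Import GRing.Theory.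
Local Open Scope ring_scope.

(* Extracting the coefficient of t^k turns the Hadamard product into an ordinary
   one, so the theorem says F_k = 1 / (1 - C_k) for each k, where F_k and C_k are
   the coefficients of the left side and of the starred series. Take the alphabet
   1' < 1 < 2' < 2 < ... < k' < k and standardize words by breaking ties from
   left to right for unprimed letters and from right to left for primed ones.
   A word with standardization pi, read in the order pi^-1, is an enriched
   (Stembridge) P-partition, and counting these gives
     sum_k #{w : std w = pi} t^k
       = 1/2 ((1 + t) / (1 - t))^(n+1) (4 t / (1 + t)^2)^(ipk pi + 1).
   So F_k sums s^occ over all words and C_k sums (s - 1)^mk over marked words
   covered by their marks. As the standardization of a factor is that of the
   same factor of pi, this is the Goulden-Jackson cluster theorem in a free
   monoid: split a word with some marked occurrences at the first position
   that no mark crosses. *)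

(** * Formal power series *)

Section PowerSeries.
Variable R : comNzRingType.
Implicit Types (a b : R) (f g : {fps R}).

Lemma fpsCE a n : fpsC a n = if n == 0%N then a else 0.
Proof. by []. Qed.

Lemma fpsC_is_zmod_morphism : zmod_morphism (@fpsC R).
Proof. by move=> a b; apply: fpsP => -[|n] //; rewrite fpsDE fpsNE /= subr0. Qed.

Lemma coef_fpsCM a f n : (fpsC a * f) n = a * f n.
Proof.
rewrite fpsME big_ord_recl subn0 fpsCE big1 ?addr0 // => i _.
by rewrite fpsCE mul0r.
Qed.

Lemma fpsC_is_monoid_morphism : monoid_morphism (@fpsC R).
Proof.
split=> // a b; apply: fpsP => n.
by rewrite coef_fpsCM !fpsCE; case: ifP; rewrite ?mulr0.
Qed.

HB.instance Definition _ :=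
  GRing.isZmodMorphism.Build R {fps R} (@fpsC R) fpsC_is_zmod_morphism.
HB.instance Definition _ :=
  GRing.isMonoidMorphism.Build R {fps R} (@fpsC R) fpsC_is_monoid_morphism.

Lemma fpsCM a b : fpsC (a * b) = fpsC a * fpsC b.
Proof. exact: rmorphM. Qed.

Lemma fps_coef_sum I (r : seq I) (P : pred I) (F : I -> {fps R}) n :
  (\sum_(i <- r | P i) F i) n = \sum_(i <- r | P i) F i n.
Proof. by elim/big_rec2: _ => // i f x _ <-. Qed.

Lemma coef_fpsXM f n : (fpsX * f) n = if n is m.+1 then f m else 0.
Proof.
rewrite fpsME; case: n => [|n]; first by rewrite big_ord1 /= mul0r.
rewrite big_ord_recl mul0r add0r big_ord_recl /= mul1r subSS subn0 big1 ?addr0 //.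
by move=> i _; rewrite mul0r.
Qed.

Lemma coef_fpsXnM f m n :
  (fpsX ^+ m * f) n = if (m <= n)%N then f (n - m)%N else 0.
Proof.
elim: m n => [|m IHm] n; first by rewrite mul1r subn0.
by rewrite exprS -mulrA coef_fpsXM; case: n => // n; rewrite IHm subSS.
Qed.

Lemma coef_fpsCXn a m n : (fpsC a * fpsX ^+ m) n = if n == m then a else 0.
Proof.
rewrite mulrC coef_fpsXnM fpsCE subn_eq0.
by case: ltngtP.
Qed.

(** Terms of index above [n] do not reach coefficient [n], so the finitely supported sum in
    [fps_sum] is a genuine finite one. *)
Lemma fps_sum_coefE k (F : nat -> {fps R}) n :
  (forall m, fps_order_ge m (F m)) ->
  fps_sum k F n = \sum_(k <= m < n.+1) F m n.
Proof.
move=> oF; rewrite [LHS]/= [RHS]fsbig_seq ?iota_uniq //; apply: esym.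
apply: fsbig_widen => m /=; rewrite mem_index_iota; first by case/andP.
case=> le_km; rewrite le_km /= ltnS => /negP.
by rewrite -ltnNge => /oF.
Qed.

(** Substituting the equation into itself [N] times leaves the remainder [f ^+ N * g], of order at
    least [N]; it is invisible at coefficient [n] for [N = n.+1]. *)
Lemma geometric_fps_sum (f g : {fps R}) :
  fps_order_ge 1 f -> g = 1 + f * g -> g = fps_sum 0 (fun n => f ^+ n).
Proof.
move=> f1 gE.
have gN N : g = \sum_(0 <= i < N) f ^+ i + f ^+ N * g.
  elim: N => [|N IHN]; first by rewrite big_nil add0r mul1r.
  by rewrite big_nat_recr //= [LHS]IHN [in LHS]gE exprSr; ring.
apply: fpsP => n; rewrite fps_sum_coefE => [|m]; last exact: fps_order_geX.
rewrite [in LHS](gN n.+1) fpsDE fps_coef_sum.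
rewrite [X in _ + X](_ : _ = 0) ?addr0 //.
have := @fps_order_geM _ n.+1 0 _ _ (fps_order_geX f1) (@fps_order_ge0 _ g).
by apply; rewrite addn0.
Qed.

End PowerSeries.

(** * Standardization of words *)

Section Standardization.
Local Open Scope nat_scope.
Implicit Types (u v w : seq nat) (i j m n : nat).

Lemma index_sorted_ltn u a :
  sorted ltn u -> a \in u -> index a u = count (fun b => b < a) u.
Proof.
elim: u => // x u IHu /= xu; rewrite inE [x == a]eq_sym.
have /allP x_lt := order_path_min ltn_trans xu.
case: eqVneq => [-> _|_ /= au]; last by rewrite x_lt // IHu ?(path_sorted xu).
rewrite ltnn; apply/esym/eqP; rewrite -leqn0 leqNgt -has_count; apply/hasPn.
by move=> b /x_lt; rewrite -leqNgt => /ltnW.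
Qed.

Lemma std_countE u : uniq u -> std u = [seq (count (fun b => b < a) u).+1 | a <- u].
Proof.
move=> u_uniq; apply/eq_in_map => a au; congr _.+1.
rewrite index_sorted_ltn ?mem_sort //; last first.
  by rewrite ltn_sorted_uniq_leq sort_uniq u_uniq sort_sorted //; apply: leq_total.
by apply/seq.permP; rewrite perm_sort.
Qed.

Lemma size_std u : size (std u) = size u.
Proof. exact: size_map. Qed.

Lemma nth_std u i : uniq u -> i < size u ->
  nth 0 (std u) i = (count (fun b => b < nth 0 u i) u).+1.
Proof. by move=> u_uniq i_lt; rewrite std_countE // (nth_map 0). Qed.

Lemma std_ltn u i j : uniq u -> i < size u -> j < size u ->
  (nth 0 (std u) i < nth 0 (std u) j) = (nth 0 u i < nth 0 u j).
Proof.
move=> u_uniq i_lt j_lt; rewrite !nth_std // ltnS.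
(* Strictness: [a] itself is counted below [b] but not below [a]. *)
have mono a b : a \in u -> a < b ->
    count (fun c => c < a) u < count (fun c => c < b) u.
  move=> au ab; apply: (@leq_trans (count (predU (fun c => c < a) (pred1 a)) u)).
    rewrite -[leqRHS]addn0 -(_ : count (predI (fun c => c < a) (pred1 a)) u = 0).
      by rewrite count_predUI -addn1 leq_add2l -has_count has_pred1.
    by apply/eqP; rewrite -leqn0 leqNgt -has_count; apply/hasPn => c _ /=; lia.
  by apply: sub_count => c /=; lia.
case: (ltngtP (nth 0 u i) (nth 0 u j)) => [lt_ij|lt_ji|->]; last exact: ltnn.
  by apply: mono; rewrite ?mem_nth.
by apply/negbTE; rewrite -leqNgt ltnW //; apply: mono; rewrite ?mem_nth.
Qed.

Lemma eq_std u v : uniq u -> uniq v -> size u = size v ->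
  (forall i j, i < size u -> j < size u ->
    (nth 0 u i < nth 0 u j) = (nth 0 v i < nth 0 v j)) ->
  std u = std v.
Proof.
move=> u_uniq v_uniq suv uv; apply: (@eq_from_nth _ 0); first by rewrite !size_std.
move=> i; rewrite size_std => i_lt; rewrite !nth_std -?suv //; congr _.+1.
rewrite -[X in count _ X = _](mkseq_nth 0 u) -[X in _ = count _ X](mkseq_nth 0 v) /mkseq !count_map -suv.
by apply: eq_in_count => j /=; rewrite mem_iota => j_lt; rewrite uv.
Qed.

Lemma uniq_std u : uniq u -> uniq (std u).
Proof.
move=> u_uniq; apply/(uniqP 0) => i j; rewrite !inE size_std => i_lt j_lt sij.
have := std_ltn u_uniq i_lt j_lt; have := std_ltn u_uniq j_lt i_lt.
rewrite sij ltnn => /esym nlt1 /esym nlt2.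
apply: (uniqP 0 u_uniq); rewrite ?inE //.
by case: ltngtP nlt1 nlt2.
Qed.

Lemma std_range u a : uniq u -> a \in std u -> 0 < a <= size u.
Proof.
move=> u_uniq; rewrite std_countE // => /mapP[b bu ->] /=.
rewrite ltn_neqAle count_size andbT -all_count.
by apply/allPn; exists b; rewrite // ltnn.
Qed.

Lemma std_take_drop u m i : uniq u ->
  std (take m (drop i (std u))) = std (take m (drop i u)).
Proof.
move=> u_uniq; apply: eq_std.
- by rewrite take_uniq ?drop_uniq ?uniq_std.
- by rewrite take_uniq ?drop_uniq.
- by rewrite !(size_take, size_drop) size_std.
move=> a b; rewrite size_take_min size_drop size_std !leq_min => /andP[am ai] /andP[bm bi].
by rewrite !nth_take // !nth_drop std_ltn //; lia.
Qed.

Section OneLine.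
Variable n : nat.
Implicit Types pi : 'S_n.

Lemma size_oneline pi : size (oneline pi) = n.
Proof. by rewrite size_map size_enum_ord. Qed.

Lemma nth_oneline pi (i : 'I_n) : nth 0 (oneline pi) i = (pi i).+1.
Proof. by rewrite (nth_map i) ?size_enum_ord // nth_ord_enum. Qed.

Lemma uniq_oneline pi : uniq (oneline pi).
Proof.
rewrite map_inj_uniq ?enum_uniq // => i j [] /val_inj; exact: perm_inj.
Qed.

Lemma oneline_inj : injective (@oneline n).
Proof.
move=> pi rho E; apply/permP => i; apply: val_inj; apply: succn_inj.
by rewrite -!nth_oneline E.
Qed.

Lemma perm_oneline pi : perm_eq (oneline pi) (iota 1 n).
Proof.
rewrite uniq_perm ?uniq_oneline ?iota_uniq // => a.
rewrite mem_iota add1n ltnS; apply/mapP/idP => [[i _ ->] //=|].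
case: a => // a /= a_lt; exists ((pi^-1)%g (Ordinal a_lt)); first by rewrite mem_enum.
by rewrite permKV.
Qed.

Lemma std_oneline pi : std (oneline pi) = oneline pi.
Proof.
rewrite std_countE ?uniq_oneline // -[RHS]map_id; apply/eq_in_map => a.
rewrite (perm_mem (perm_oneline pi)) mem_iota (seq.permP (perm_oneline pi)).
case: a => // a; rewrite add1n /= ltnS => a_lt; congr _.+1.
rewrite -(subnKC (ltnW a_lt)) iotaD count_cat.
rewrite [X in _ + X](_ : _ = 0); last first.
  apply/eqP; rewrite -leqn0 leqNgt -has_count; apply/hasPn => c.
  by rewrite mem_iota; lia.
rewrite addn0 -[RHS](size_iota 1 a); apply/eqP; rewrite -all_count.
by apply/allP => c; rewrite mem_iota; lia.
Qed.

Lemma oneline_surj u : size u = n -> uniq u -> (forall a, a \in u -> 0 < a <= n) ->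
  exists pi : 'S_n, oneline pi = u.
Proof.
move=> su u_uniq u_range.
have range_u i : i < n -> 0 < nth 0 u i <= n by rewrite -su => /(mem_nth 0)/u_range; rewrite su.
have lt_u (i : 'I_n) : (nth 0 u i).-1 < n by have := range_u i (ltn_ord i); lia.
have f_inj : injective (fun i : 'I_n => Ordinal (lt_u i)).
  move=> i j [] E; apply: val_inj; apply: (uniqP 0 u_uniq); rewrite ?inE ?su ?ltn_ord //.
  case/andP: (range_u i (ltn_ord i)) => i_gt0 _.
  case/andP: (range_u j (ltn_ord j)) => j_gt0 _.
  by rewrite -[LHS](prednK i_gt0) E prednK.
exists (perm f_inj); apply: (@eq_from_nth _ 0); first by rewrite size_oneline.
move=> i; rewrite size_oneline => i_lt.
rewrite (nth_oneline _ (Ordinal i_lt)) permE /= prednK //.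
by case/andP: (range_u i i_lt).
Qed.

Lemma oneline_stdP u pi : uniq u -> size u = n ->
  reflect (forall i j : 'I_n, (nth 0 u i < nth 0 u j) = (pi i < pi j))
          (std u == oneline pi).
Proof.
move=> u_uniq su; apply: (iffP eqP) => [E i j|E].
  by rewrite -std_ltn ?su // E !nth_oneline ltnS.
rewrite -std_oneline; apply: eq_std; rewrite ?uniq_oneline ?size_oneline //.
rewrite su => i j i_lt j_lt.
by rewrite (nth_oneline _ (Ordinal i_lt)) (nth_oneline _ (Ordinal j_lt)) ltnS -E.
Qed.

End OneLine.

End Standardization.

(** * Words over the primed alphabet and their factors *)

Section Words.
Local Open Scope nat_scope.
Implicit Types (u v w : seq nat) (a i j m n K : nat).

(* The letters j' and j of the alphabet are encoded as 2(j-1) and 2(j-1)+1, so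
   that unprimed letters are odd. *)
Definition ltw w i j :=
  (nth 0 w i < nth 0 w j) ||
  (nth 0 w i == nth 0 w j) && (if odd (nth 0 w i) then i < j else j < i).

(* Distinct numbers in the order of [ltw], to which [std] applies. *)
Definition wkey w :=
  mkseq (fun i => nth 0 w i * size w +
                  (if odd (nth 0 w i) then i else size w - i.+1)) (size w).

Lemma size_wkey w : size (wkey w) = size w.
Proof. exact: size_mkseq. Qed.

Lemma wkey_ltn w i j : i < size w -> j < size w ->
  (nth 0 (wkey w) i < nth 0 (wkey w) j) = ltw w i j.
Proof.
move=> i_lt j_lt; rewrite /wkey !nth_mkseq // /ltw.
(* The tie-breaking terms stay below [size w], so the letters decide first. *)
have mono a b r r' : a < b -> r < size w -> a * size w + r < b * size w + r'.
  move=> ab r_lt; apply: (@leq_trans (a.+1 * size w)); first by rewrite mulSn addnC ltn_add2r.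
  by apply: leq_trans (leq_addr _ _); rewrite leq_mul2r ab orbT.
case: (ltngtP (nth 0 w i)) => [lt_ij|lt_ji|->] /=.
- by apply: mono => //; case: ifP => _; lia.
- by apply/negbTE; rewrite -leqNgt ltnW //; apply: mono => //; case: ifP => _; lia.
- by rewrite ltn_add2l; case: ifP => _; lia.
Qed.

Lemma uniq_wkey w : uniq (wkey w).
Proof.
apply/(uniqP 0) => i j; rewrite !inE size_wkey => i_lt j_lt E.
have := wkey_ltn i_lt j_lt; have := wkey_ltn j_lt i_lt; rewrite E ltnn /ltw.
case: (ltngtP (nth 0 w i)) => //= -> ; case: ifP => _; case: ltngtP => //.
Qed.

Definition wstd w := std (wkey w).

Lemma size_wstd w : size (wstd w) = size w.
Proof. by rewrite size_std size_wkey. Qed.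

(** The default [1%g] is reached only when [size w] differs from [n]. *)
Definition wperm n w : 'S_n := odflt 1%g [pick pi : 'S_n | oneline pi == wstd w].

Lemma oneline_wperm n w : size w = n -> oneline (wperm n w) = wstd w.
Proof.
move=> sw; rewrite /wperm; case: pickP => [pi /eqP // | no].
have [||a /std_range|pi E] := @oneline_surj n (wstd w).
- by rewrite size_wstd.
- exact: uniq_std (uniq_wkey w).
- by rewrite size_wkey sw; apply; apply: uniq_wkey.
- by have := no pi; rewrite E eqxx.
Qed.

Lemma wperm_eq n w (pi : 'S_n) : size w = n ->
  (wperm n w == pi) = (oneline pi == wstd w).
Proof.
move=> sw; rewrite -(oneline_wperm sw) eq_sym.
by apply/eqP/eqP => [->|/oneline_inj].
Qed.

(** The rule for ties looks only at the parity of the common letter and at which position comes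
    first; both survive in a factor. *)
Lemma wstd_take_drop w m i :
  std (take m (drop i (wstd w))) = wstd (take m (drop i w)).
Proof.
rewrite std_take_drop ?uniq_wkey //; apply: eq_std; rewrite ?uniq_wkey //.
- by rewrite take_uniq ?drop_uniq ?uniq_wkey.
- by rewrite size_wkey !(size_take, size_drop) size_wkey.
move=> a b; rewrite size_take_min size_drop size_wkey !leq_min.
case/andP=> [am ai] /andP[bm bi]; rewrite wkey_ltn; last 2 first.
- by rewrite size_take_min size_drop leq_min am.
- by rewrite size_take_min size_drop leq_min bm.
rewrite !nth_take // !nth_drop wkey_ltn /ltw; try lia.
by rewrite !nth_take // !nth_drop !ltn_add2l.
Qed.

Lemma occurrence_wperm n w m (sigma : 'S_m) i : size w = n ->
  occurrence sigma (wperm n w) i =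
  (0 < i <= n.+1 - m) && (wperm m (take m (drop i.-1 w)) == sigma).
Proof.
move=> sw; rewrite /occurrence oneline_wperm // wstd_take_drop.
case: (boolP (0 < i <= n.+1 - m)) => //= /andP[i_gt0 i_le].
rewrite wperm_eq 1?eq_sym //; rewrite size_take_min size_drop sw; lia.
Qed.

Fixpoint words K n : seq (seq nat) :=
  if n is n'.+1 then [seq c :: w | c <- iota 0 K, w <- words K n'] else [:: [::]].

Lemma mem_words K n w : (w \in words K n) = (size w == n) && all (fun c => c < K) w.
Proof.
elim: n w => [|n IHn] w; first by case: w.
apply/allpairsP/idP => [[[c v] [/= c_lt]]|].
  move: c_lt; rewrite IHn mem_iota /= => c_lt /andP[/eqP <- v_lt] ->.
  by rewrite /= eqxx c_lt.
case: w => // c v; rewrite /= eqSS => /and3P[sv c_lt v_lt].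
by exists (c, v); rewrite IHn sv v_lt mem_iota.
Qed.

Lemma size_word K n w : w \in words K n -> size w = n.
Proof. by rewrite mem_words => /andP[/eqP]. Qed.

Lemma uniq_words K n : uniq (words K n).
Proof.
elim: n => // n IHn; rewrite allpairs_uniq ?iota_uniq //.
by move=> [c v] [d w] _ _ [-> ->].
Qed.

End Words.

Lemma big_wordsS (R : nmodType) K n (F : seq nat -> R) :
  \sum_(w <- words K n.+1) F w = \sum_(0 <= c < K) \sum_(w <- words K n) F (c :: w).
Proof. by rewrite big_allpairs_dep /index_iota subn0. Qed.

Lemma big_words_cat (R : nmodType) K m n (F : seq nat -> R) :
  \sum_(w <- words K (m + n)) F w =
  \sum_(u <- words K m) \sum_(v <- words K n) F (u ++ v).
Proof.
elim: m F => [|m IHm] F; first by rewrite big_seq1.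
by rewrite addSn !big_wordsS; apply: eq_bigr => c _; rewrite IHm.
Qed.

(** * Goulden-Jackson inversion for sets of intervals *)

Section Intervals.
Variables (n : nat) (R : comNzRingType) (y : R).
Notation interval := ('I_n.+1 * 'I_n.+1)%type.
Variable D : {set interval}.
Implicit Types (S : {set interval}) (p q : nat).

(** Numbers stand for the gaps before, between and after the letters of a word, and a pair of gaps
    for the factor between them. *)
Definition intervals_in p q : {set interval} :=
  [set ab in D | (p <= ab.1)%N && (ab.1 < ab.2 <= q)%N].

Definition cut q S := [forall ab in S, ~~ (ab.1 < q < ab.2)%N].

Definition covering q S := [forall g : 'I_n.+1, (0 < g < q)%N ==> ~~ cut g S].

Lemma cutP q S : reflect {in S, forall ab : interval, ~~ (ab.1 < q < ab.2)%N} (cut q S).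
Proof. exact: forall_inP. Qed.

Lemma coveringP q S :
  reflect (forall g : 'I_n.+1, (0 < g < q)%N -> ~~ cut g S) (covering q S).
Proof. by apply: (iffP forallP) => H g; [apply/implyP | apply/implyP/H]. Qed.

(** [ord_max] is the starting candidate: no interval extends past [n], so it is always a cut. *)
Definition first_cut S : 'I_n.+1 :=
  [arg min_(g < ord_max | (0 < g)%N && cut g S) (g : nat)]%N.

Lemma first_cut_eq S (q : 'I_n.+1) : (0 < n)%N -> S \subset intervals_in 0 n ->
  (first_cut S == q) = [&& (0 < q)%N, covering q S & cut q S].
Proof.
move=> n_gt0 /subsetP S_in; rewrite /first_cut; case: arg_minnP => [|g /andP[g_gt0 g_cut] g_min].
  rewrite n_gt0 /=; apply/cutP => ab /S_in; rewrite inE => /andP[_].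
  by move=> /= /andP[_ ab2]; rewrite negb_and -!leqNgt ab2 orbT.
apply/eqP/and3P => [<-|[q_gt0 /coveringP q_cov q_cut]].
  split=> //; apply/coveringP => h /andP[h_gt0 h_lt]; apply/negP => h_cut.
  by have := g_min h; rewrite h_gt0 h_cut leqNgt h_lt => /(_ isT).
apply/val_inj/eqP; rewrite eqn_leq g_min ?q_gt0 //= leqNgt.
by apply/negP => g_lt; have := q_cov g; rewrite g_gt0 g_lt g_cut => /(_ isT).
Qed.

Definition sub_gf (A : {set interval}) (P : pred {set interval}) : R :=
  \sum_(S : {set interval} | (S \subset A) && P S) y ^+ #|S|.

(** If no interval crosses [q], the set splits uniquely into a part left of [q] and a part right of
    it. Gaps below [q] can only be crossed by the left part, so covering is a condition on that part
    alone. *)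
Lemma sub_gf_cut (q : 'I_n.+1) : (0 < q)%N ->
  sub_gf (intervals_in 0 n) (fun S => covering q S && cut q S) =
  sub_gf (intervals_in 0 q) (covering q) * sub_gf (intervals_in q n) xpredT.
Proof.
move=> q_gt0; rewrite /sub_gf big_distrlr pair_big /=.
pose h (SS : {set interval} * {set interval}) := SS.1 :|: SS.2.
pose h' S := (S :&: intervals_in 0 q, S :&: intervals_in q n).
have q_le := ltn_ord q.
(* Intervals are nondegenerate, so none lies on both sides of [q]. *)
have lr ab : ab \in intervals_in 0 q -> ab \notin intervals_in q n.
  by rewrite !inE => /andP[-> /=]; lia.
have cutU S : S \subset intervals_in 0 n -> cut q S ->
    S \subset intervals_in 0 q :|: intervals_in q n.
  move=> /subsetP S_in /cutP S_cut; apply/subsetP => ab abS.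
  by move: (S_in _ abS) (S_cut _ abS); rewrite !inE => /andP[-> /=]; lia.
rewrite (reindex_onto h h') => [|S /and3P[S_in _ S_cut]]; last first.
  by rewrite /h /= -setIUr; apply/setIidPl; apply: cutU.
have hK S1 S2 : S1 \subset intervals_in 0 q -> S2 \subset intervals_in q n ->
    h' (S1 :|: S2) = (S1, S2).
  move=> /subsetP S1_in /subsetP S2_in; rewrite /h'; congr (_, _); apply/setP => ab;
    rewrite in_setI in_setU.
  - have := S1_in ab; have := S2_in ab; have := lr ab.
    by case: (ab \in S1) => [_ _ ->//|]; case: (ab \in S2) => //=;
       case: (ab \in intervals_in 0 q) => //= /(_ isT)/negbTE -> /(_ isT).
  - have := S1_in ab; have := S2_in ab; have := lr ab.
    case: (ab \in S2) => [_ -> //|]; first by rewrite orbT.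
    by case: (ab \in S1) => //= H _ /(_ isT)/H/negbTE.
apply: eq_big => [[S1 S2]|[S1 S2]] /=.
  rewrite andbT; apply/andP/andP => [[/and3P[_ S_cov S_cut] /eqP E]|[]].
    have S1_in : S1 \subset intervals_in 0 q by case: E => <- _; apply: subsetIr.
    have S2_in : S2 \subset intervals_in q n by case: E => _ <-; apply: subsetIr.
    split=> //; rewrite S1_in /=; apply/coveringP => g g_lt.
    move/coveringP: S_cov => /(_ g g_lt); apply: contra => /cutP g_cut.
    apply/cutP => ab; rewrite in_setU => /orP[/g_cut//|/(subsetP S2_in)].
    by rewrite inE => /andP[_ /=]; lia.
  move=> /andP[S1_in S1_cov] S2_in; rewrite hK // eqxx; split=> //.
  apply/and3P; split.
  - apply/subsetP => ab; rewrite in_setU => /orP[/(subsetP S1_in)|/(subsetP S2_in)];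
    by rewrite !inE => /andP[-> /=]; lia.
  - apply/coveringP => g /(coveringP _ _ S1_cov); apply: contra => /cutP g_cut.
    by apply/cutP => ab ab1; apply: g_cut; rewrite in_setU ab1.
  - apply/cutP => ab; rewrite in_setU => /orP[/(subsetP S1_in)|/(subsetP S2_in)];
    by rewrite !inE => /andP[_ /=]; lia.
case/andP=> _ /eqP E.
have S1_in : S1 \subset intervals_in 0 q by case: E => <- _; apply: subsetIr.
have S2_in : S2 \subset intervals_in q n by case: E => _ <-; apply: subsetIr.
rewrite -exprD /h /= cardsU; congr (_ ^+ _).
rewrite (_ : S1 :&: S2 = finset.set0) ?cards0 ?subn0 //; apply/setP => ab.
rewrite !inE; apply/negP => /andP[/(subsetP S1_in)/lr/negP H /(subsetP S2_in)].
exact: H.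
Qed.

(** The sets are sorted by their first cut [j.+1]; the value [n] belongs to the sets that cross
    every inner gap. *)
Lemma sub_gf_first_block : (0 < n)%N ->
  sub_gf (intervals_in 0 n) xpredT =
  \sum_(j < n) sub_gf (intervals_in 0 j.+1) (covering j.+1)
               * sub_gf (intervals_in j.+1 n) xpredT.
Proof.
move=> n_gt0; rewrite {1}/sub_gf (partition_big first_cut (fun q : 'I_n.+1 => 0 < q)%N) => [|S]; last first.
  by rewrite andbT => S_in; have := eqxx (first_cut S); rewrite first_cut_eq // => /and3P[].
rewrite big_mkcond big_ord_recl /= add0r; apply: eq_bigr => j _.
rewrite -(@sub_gf_cut (lift ord0 j)) //; apply: eq_bigl => S; rewrite andbT.
by apply: andb_id2l => S_in; rewrite first_cut_eq.
Qed.

End Intervals.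

(** Expand the product of [1 + y] over [A]. The product runs over all of [T], and an element chosen
    outside [A] contributes the factor 0. *)
Lemma sum_subsets (T : finType) (R : comNzRingType) (y : R) (A : {set T}) :
  \sum_(S : {set T} | S \subset A) y ^+ #|S| = (1 + y) ^+ #|A|.
Proof.
have := bigA_distr 1 +%R (fun a => if a \in A then y else 0) (fun=> 1 : R).
rewrite (eq_bigr (fun a => if a \in A then 1 + y else 1)) => [|a _]; last first.
  by case: ifP; rewrite /= ?add0r // addrC.
rewrite -big_mkcond prodr_const => ->; rewrite [LHS]big_mkcond; apply: eq_bigr => S _.
rewrite -big_mkcond; case: ifPn => [/subsetP SA|/subsetPn[a aS aA]].
  by rewrite -prodr_const; apply: eq_bigr => a /SA ->.
by rewrite (bigD1 a) //= (negbTE aA) mul0r.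
Qed.

(** Serves to pass from sets of marked occurrences to sets of intervals. *)
Lemma sum_subsets_imset (T U : finType) (R : comNzRingType) (y : R)
    (f : T -> U) (A : {set T}) (P : pred {set T}) (Q : pred {set U}) :
  {in A &, injective f} ->
  (forall S : {set T}, S \subset A -> Q (f @: S) = P S) ->
  \sum_(S : {set U} | (S \subset f @: A) && Q S) y ^+ #|S| =
  \sum_(S : {set T} | (S \subset A) && P S) y ^+ #|S|.
Proof.
move=> f_inj PQ.
have SK (S : {set T}) : S \subset A -> A :&: f @^-1: (f @: S) = S.
  move=> /subsetP SA; apply/setP => a; rewrite !inE; apply/andP/idP => [[aA /imsetP[b bS E]]|aS].
    by rewrite (f_inj a b) // SA.
  by rewrite SA // imset_f.
rewrite (reindex_onto (fun S : {set T} => f @: S) (fun S : {set U} => A :&: f @^-1: S)) => [|S /andP[/subsetP SA _]].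
  apply: eq_big => S.
    apply/andP/andP => [[/andP[_ QS] /eqP E]|[SA PS]].
      have SA : S \subset A by rewrite -E subsetIl.
      by rewrite -PQ.
    by rewrite imsetS // PQ // SK.
  case/andP=> _ /eqP E; rewrite card_in_imset // => a b aS bS.
  by apply: f_inj; [move: aS | move: bS]; rewrite -E inE => /andP[].
apply/setP => b; apply/imsetP/idP => [[a]|bS].
  by rewrite !inE => /andP[_ ?] ->.
by have /imsetP[a aA E] := SA b bS; exists a; rewrite // !inE aA -E.
Qed.

(** * Marked occurrences in a word as intervals *)

Section MarkedWords.
Variable Gamma : permset.
Hypothesis Gamma_ge2 : forall (m : nat) (sigma : 'S_m), sigma \in Gamma m -> (2 <= m)%N.
Implicit Types (u v w : seq nat).
Local Open Scope nat_scope.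

Definition factor w a b := take (b - a) (drop a w).

Definition in_pattern m w := wperm m w \in Gamma m.

(** The bound [N] is independent of the length of [w], so that a word and its factors have their
    intervals in one type. Pairs running past the end of [w] are meaningless; [intervals_in] with
    upper end [size w] discards them. *)
Definition marked_factors N w : {set 'I_N.+1 * 'I_N.+1} :=
  [set ab : 'I_N.+1 * 'I_N.+1 | in_pattern (ab.2 - ab.1) (factor w ab.1 ab.2)].

Lemma factor_catl u v a b : b <= size u -> factor (u ++ v) a b = factor u a b.
Proof.
move=> b_le; have [a_lt|a_ge] := ltnP a (size u); last first.
  by rewrite /factor (_ : b - a = 0) ?take0 //; lia.
rewrite /factor drop_cat a_lt takel_cat // size_drop; lia.
Qed.

Lemma factor_catr u v a b : factor (u ++ v) (a + size u) (b + size u) = factor v a b.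
Proof. by rewrite /factor subnDr drop_cat ltnNge leq_addl /= addnK. Qed.

Lemma marked_factors_catl N u v p :
  intervals_in (marked_factors N (u ++ v)) p (size u) =
  intervals_in (marked_factors N u) p (size u).
Proof.
apply/setP => ab; rewrite !inE.
by apply: andb_id2r => /and3P[_ _ ab2]; rewrite factor_catl.
Qed.

(** Translation by [size u] is a bijection; the bound on the sizes keeps [inord] away from its
    default value. *)
Lemma card_marked_factors_catr N u v : size u + size v <= N ->
  #|intervals_in (marked_factors N (u ++ v)) (size u) (size u + size v)| =
  #|intervals_in (marked_factors N v) 0 (size v)|.
Proof.
move=> uvN.
pose f (ab : 'I_N.+1 * 'I_N.+1) : 'I_N.+1 * 'I_N.+1 :=
  (inord (ab.1 + size u), inord (ab.2 + size u)).
rewrite -[RHS](@card_in_imset _ _ f) => [|[a b] [c d]].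
  congr #|pred_of_set _|; apply/setP => -[a b]; apply/idP/imsetP => [|[[c d]]].
    rewrite !inE /= => /andP[ab_in /andP[ua /andP[ab b_le]]].
    exists (inord (a - size u), inord (b - size u)).
      rewrite !inE /= !inordK; try lia.
      rewrite -(factor_catr u) !subnK; try lia.
      rewrite (_ : b - size u - (a - size u) = b - a); last by lia.
      rewrite ab_in /=; lia.
    by rewrite /f /= !inordK ?subnK; try lia; rewrite !inord_val.
  rewrite !inE /= => /andP[cd_in /andP[cd d_le]] [-> ->].
  rewrite !inordK; try lia.
  rewrite factor_catr (_ : d + size u - (c + size u) = d - c); last by lia.
  rewrite cd_in /=; lia.
rewrite !inE /= => /andP[_ ab] /andP[_ cd] [/(congr1 val) E1 /(congr1 val) E2].
by move: E1 E2; rewrite /= !inordK; try lia; move=> E1 E2; congr (_, _); apply: val_inj => /=; lia.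
Qed.

(** Positions start at 1 and gaps at 0, hence the predecessor. *)
Definition span_of N n (p : marking n) : 'I_N.+1 * 'I_N.+1 :=
  (inord (mk_pos p).-1, inord ((mk_pos p).-1 + mk_len p)).

Section OnWord.
Variables (N n : nat) (w : seq nat).
Hypotheses (size_w : size w = n) (le_nN : n <= N).

Lemma mem_marked_occs (p : marking n) :
  (p \in marked_occs Gamma (wperm n w)) =
  [&& mk_pat p \in Gamma (mk_len p), 0 < mk_pos p <= n.+1 - mk_len p &
      wperm (mk_len p) (take (mk_len p) (drop (mk_pos p).-1 w)) == mk_pat p].
Proof. by rewrite inE occurrence_wperm. Qed.

Lemma val_span_of (p : marking n) : p \in marked_occs Gamma (wperm n w) ->
  ((span_of N p).1 = (mk_pos p).-1 :> nat) *
  ((span_of N p).2 = (mk_pos p).-1 + mk_len p :> nat).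
Proof.
rewrite mem_marked_occs => /and3P[pG /andP[p_gt0 p_le] _].
have := Gamma_ge2 pG => len2.
by split; rewrite inordK; lia.
Qed.

(** The interval gives the position and the length; the pattern is then forced, being the
    standardization of that factor of [w]. *)
Lemma span_of_inj :
  {in marked_occs Gamma (wperm n w) &, injective (@span_of N n)}.
Proof.
move=> p p' p_in p'_in E.
have := val_span_of p_in; have := val_span_of p'_in; rewrite E => -[-> ->] [E1 E2].
move: p_in p'_in; rewrite !mem_marked_occs => /and3P[_ /andP[p_gt0 _] /eqP pE].
case/and3P=> _ /andP[p'_gt0 _] /eqP p'E.
have {}E1 : mk_pos p = mk_pos p' by lia.
have {}E2 : mk_len p = mk_len p' by lia.
move: E1 E2 pE p'E; case: p p' {E p_gt0 p'_gt0} => [m [i sigma]] [m' [i' sigma']].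
rewrite /mk_pos /mk_len /mk_pat /= => /val_inj ii /val_inj mm; subst m' i'.
by move=> -> ->.
Qed.

Lemma span_of_marked_occs :
  [set span_of N p | p in marked_occs Gamma (wperm n w)] =
  intervals_in (marked_factors N w) 0 n.
Proof.
apply/setP => ab; apply/imsetP/idP => [[p p_in ->]|].
  have [E1 E2] := val_span_of p_in.
  rewrite !inE /= E1 E2 /in_pattern /factor addKn; move: p_in; rewrite mem_marked_occs.
  by case/and3P=> pG /andP[? ?] /eqP ->; rewrite pG /=; have := Gamma_ge2 pG; lia.
case: ab => a b; rewrite !inE /= => /andP[ab_in /andP[ab b_le]].
have m_lt : b - a < n.+1 by lia.
have a_lt : a.+1 < n.+2 by lia.
exists (existT (fun m : 'I_n.+1 => 'I_n.+2 * 'S_m)%type (Ordinal m_lt)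
               (Ordinal a_lt, wperm (b - a) (factor w a b))).
  rewrite mem_marked_occs /mk_pos /mk_len /mk_pat /= [_ \in _]ab_in eqxx andbT /=; lia.
rewrite /span_of /mk_pos /mk_len /= subnKC; last by lia.
by rewrite !inord_val.
Qed.

Lemma occ_wperm :
  occ Gamma (wperm n w) = #|intervals_in (marked_factors N w) 0 n|.
Proof. by rewrite -span_of_marked_occs card_in_imset //; apply: span_of_inj. Qed.

(** A mark covers [j] in the sense of [clusters] exactly when its interval crosses the gap [j]. *)
Lemma clusters_wperm (S : {set marking n}) : 1 < n ->
  (S \in clusters Gamma (wperm n w)) =
  (S \subset marked_occs Gamma (wperm n w)) &&
  covering n [set span_of N p | p in S].
Proof.
move=> n_gt1; rewrite inE; apply: andb_id2l => /subsetP SO.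
apply/andP/coveringP => [[_ /forallP S_cov] g /andP[g_gt0 g_lt]|S_cov].
  have /exists_inP[p pS] := implyP (S_cov (Ordinal g_lt)) g_gt0.
  move=> /= p_g; apply/negP => /cutP /(_ (span_of N p) (imset_f _ pS)).
  rewrite !val_span_of ?SO //; move: (SO p pS).
  by rewrite mem_marked_occs => /and3P[_ /andP[? _] _]; lia.
have cov g : 0 < g < n -> exists2 p, p \in S &
    (mk_pos p <= g) && (g < (mk_pos p + mk_len p).-1).
  move=> g_lt; have := S_cov (inord g); rewrite inordK; last by lia.
  move=> /(_ g_lt) /forall_inPn[_ /imsetP[p pS ->]]; rewrite negbK.
  rewrite !val_span_of ?SO // => p_g; exists p => //; move: p_g (SO p pS).
  by rewrite mem_marked_occs => ? /and3P[_ /andP[? _] _]; lia.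
(* Since [1 < n], the gap 1 has to be crossed, which makes [S] nonempty. *)
split; first by have [|p pS _] := cov 1; [lia | apply/set0Pn; exists p].
apply/forallP => g; apply/implyP => g_gt0; apply/exists_inP.
by apply: cov; rewrite g_gt0 ltn_ord.
Qed.

End OnWord.
End MarkedWords.

(** * Words with a given standardization *)

Section CountWords.
Local Open Scope nat_scope.
Implicit Types (ds : seq bool) (g w : seq nat) (K L : nat).

(* Words read in the order of a permutation are listed from the largest letter
   down; [d] tells whether the permutation descends at this place. *)
Definition step d c c' := (c' < c) || (c' == c) && (odd c (+) d).

Definition descending ds g :=
  all (fun j => step (nth false ds j) (nth 0 g j) (nth 0 g j.+1)) (iota 0 (size ds)).

Lemma descending_cons d ds c g :
  descending (d :: ds) (c :: g) = step d c (nth 0 g 0) && descending ds g.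
Proof. by rewrite /descending /= (iotaDl 1 0) all_map. Qed.

(* The number of descending words with all letters below [K]. A repeated letter
   is allowed exactly when [odd c (+) d]. *)
Fixpoint count_desc ds K : nat :=
  if ds is d :: ds' then \sum_(0 <= c < K) count_desc ds' (c + (odd c (+) d)) else K.

Lemma sum_nat_ltn K L F : L <= K ->
  \sum_(0 <= c < K) (c < L) * F c = \sum_(0 <= c < L) F c.
Proof.
move=> leLK; rewrite (@big_cat_nat _ _ _ L) //= [X in _ + X]big_nat_cond [X in _ + X]big1 ?addn0.
  by apply: eq_big_nat => c /= ->; rewrite mul1n.
by move=> c /andP[/andP[/leq_gtF -> _] _].
Qed.

(** The bound [L] on the first letter carries the induction: after a first letter [c] the next one
    is below [c], or equal to it when [odd c (+) d], so the new bound is [c + (odd c (+) d)]. *)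
Lemma count_descE K L ds : L <= K ->
  \sum_(g <- words K (size ds).+1) (nth 0 g 0 < L) && descending ds g =
  count_desc ds L.
Proof.
elim: ds L => [|d ds IHds] L leLK; rewrite big_wordsS.
  under eq_bigr => c _ do rewrite big_seq1 /= andbT -[nat_of_bool _]muln1.
  by rewrite sum_nat_ltn // sum_nat_const_nat subn0 muln1.
rewrite [RHS]/= -(sum_nat_ltn _ leLK); apply: eq_big_nat => c /= c_lt.
case: ltnP => c_lt' /=; last by rewrite mul0n big1.
rewrite mul1n -IHds; last by case: (_ (+) _); lia.
apply: eq_bigr => g _; rewrite descending_cons; congr (nat_of_bool (_ && _)).
by rewrite /step; case: (_ (+) d); rewrite ?andbT ?andbF ?orbF ?addn0 ?addn1 ?ltnS; lia.
Qed.

(** Descents are listed from the last one down, like the letters of a descending word. *)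
Fixpoint downto (D : nat -> bool) k : seq bool :=
  if k is k'.+1 then D k' :: downto D k' else [::].

Lemma size_downto D k : size (downto D k) = k.
Proof. by elim: k => //= k ->. Qed.

Lemma nth_downto D k j : j < k -> nth false (downto D k) j = D (k - j.+1).
Proof. by elim: k j => // k IHk [|j] /=; rewrite ?subn1 // ltnS => /IHk ->. Qed.

(** In the reversed list a peak is a descent followed by an ascent. The default [true] prevents a
    peak at the first position of the permutation. *)
Fixpoint peaks ds : nat :=
  if ds is d :: ds' then (d && ~~ head true ds') + peaks ds' else 0.

Definition descent n (pi : 'S_n) i := letter pi i.+2 < letter pi i.+1.

Lemma peaks_descents n (pi : 'S_n) : pk pi = peaks (downto (descent pi) n.-1).
Proof.
have pkE k : k < n ->
    count (is_peak pi) (index_iota 2 k.+1) = peaks (downto (descent pi) k).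
  elim: k => [|k IHk] // k_lt; rewrite [RHS]/= -IHk 1?ltnW //.
  case: k k_lt {IHk} => [|k] k_lt; first by rewrite andbF.
  rewrite /index_iota !subSS !subn0 -[in iota 2 k.+1](addn1 k) iotaD count_cat addnC; congr (_ + _).
  rewrite [LHS]/= addn0 add2n /is_peak /descent andbC -leqNgt [letter pi k.+2.-1]/=.
  congr (nat_of_bool (_ && _)); rewrite [LHS]ltn_neqAle andb_idl // => _.
  rewrite /letter nth_uniq ?uniq_oneline ?size_oneline; lia.
case: n pi pkE => [|n] pi pkE; first by rewrite /pk.
by rewrite -pkE.
Qed.

Section PermWord.
Variables (n : nat) (sigma : 'S_n).

Definition perm_word w := [seq nth 0 w (sigma (rev_ord j)) | j <- enum 'I_n].

Lemma nth_perm_word w (j : 'I_n) : nth 0 (perm_word w) j = nth 0 w (sigma (rev_ord j)).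
Proof. by rewrite (nth_map j) ?size_enum_ord // nth_ord_enum. Qed.

(** Rearranging positions maps the finite list [words K n] injectively into itself, hence permutes
    it. *)
Lemma count_perm_word K (P : pred (seq nat)) :
  count (fun w => P (perm_word w)) (words K n) = count P (words K n).
Proof.
have inj : {in words K n &, injective perm_word}.
  move=> w w' /size_word sw /size_word sw' E; apply: (@eq_from_nth _ 0); rewrite sw ?sw' //.
  move=> i i_lt; pose j := rev_ord ((sigma^-1)%g (Ordinal i_lt)).
  have := congr1 (fun v => nth 0 v j) E; rewrite !nth_perm_word rev_ordK permKV.
  exact: id.
rewrite -(count_map perm_word P); apply/seq.permP; apply: uniq_perm.
- by rewrite map_inj_in_uniq ?uniq_words.
- exact: uniq_words.
apply: (uniq_min_size _ _ _).2; first by rewrite map_inj_in_uniq ?uniq_words.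
  move=> _ /mapP[w w_in ->]; rewrite mem_words size_map size_enum_ord eqxx /=.
  move: w_in; rewrite mem_words => /andP[/eqP sw /allP w_lt].
  by apply/allP => _ /mapP[j _ ->]; apply: w_lt; rewrite mem_nth ?sw.
by rewrite size_map.
Qed.

End PermWord.

(** The standardization is [pi] exactly when the keys increase along the positions listed by
    [pi^-1]. By transitivity only neighbours matter; between equal letters the parity of the letter
    and the descents of [pi^-1] decide. *)
Lemma wperm_descending n (pi : 'S_n) w : size w = n ->
  (wperm n w == pi) =
  descending (downto (descent (pi^-1)%g) n.-1) (perm_word (pi^-1)%g w).
Proof.
case: n pi => [|n] pi sw; first by apply/eqP/permP => -[].
set sigma := (pi^-1)%g; rewrite wperm_eq // eq_sym /wstd.
(* The key of the letter that should get rank [i], counted from 0. *)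
pose key i := nth 0 (wkey w) (sigma (inord i)).
have keyE i : i < n -> (key i < key i.+1) =
    step (descent sigma i) (nth 0 w (sigma (inord i.+1))) (nth 0 w (sigma (inord i))).
  move=> i_lt; rewrite /key wkey_ltn ?sw //.
  have letterE j : j < n.+1 -> letter sigma j.+1 = (sigma (inord j)).+1.
    by move=> j_lt; rewrite -nth_oneline inordK.
  rewrite /descent letterE // letterE ?ltnS /step /ltw; last exact: ltnW.
  case: eqVneq => [->|//].
  rewrite !ltnn /= addbC; case: (odd _); rewrite ?addbF // addbT -leqNgt ltn_neqAle.
  apply: andb_idl => _; rewrite (inj_eq val_inj) (inj_eq perm_inj) -(inj_eq val_inj) /=.
  by rewrite !inordK //; lia.
have -> : descending (downto (descent sigma) n) (perm_word sigma w) =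
    all (fun i => key i < key i.+1) (iota 0 n).
  rewrite /descending size_downto.
  have revE j : j < n -> step (nth false (downto (descent sigma) n) j)
      (nth 0 (perm_word sigma w) j) (nth 0 (perm_word sigma w) j.+1) =
      (key (n - j.+1) < key (n - j.+1).+1).
    move=> j_lt; rewrite keyE ?nth_downto; try lia.
    have nthE i : i < n.+1 ->
        nth 0 (perm_word sigma w) i = nth 0 w (sigma (inord (n - i))).
      move=> i_lt; rewrite -[i in LHS]/(val (Ordinal i_lt)) nth_perm_word.
      congr (nth 0 w (sigma _)); apply: val_inj; rewrite /= inordK; lia.
    by rewrite !nthE ?subnSK //; lia.
  apply/allP/allP => H j; rewrite mem_iota => /andP[_ j_lt].
    rewrite (_ : j = n - (n - j.+1).+1); last by lia.
    by rewrite -revE; [apply: H; rewrite mem_iota | ]; lia.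
  by rewrite revE //; apply: H; rewrite mem_iota; lia.
have sk : size (wkey w) = n.+1 by rewrite size_wkey.
have nth_key (i : 'I_n.+1) : nth 0 (wkey w) i = key (pi i).
  by rewrite /key inord_val permK.
apply/(oneline_stdP _ (uniq_wkey w) sk)/allP => [H i|H i j].
  rewrite mem_iota /= => i_lt; rewrite /key H !permKV !inordK //; lia.
have inc d a : a + d.+1 < n.+1 -> key a < key (a + d.+1).
  elim: d => [|d IHd] a_lt; first by rewrite addn1; apply: H; rewrite mem_iota; lia.
  rewrite addnS; apply: (ltn_trans (IHd _)); first by lia.
  by apply: H; rewrite mem_iota; lia.
have inc2 a b : a < b -> b < n.+1 -> key a < key b.
  by move=> ab b_lt; rewrite -(subnKC ab) addSnnS; apply: inc; lia.
rewrite !nth_key; case: (ltngtP (pi i) (pi j)) => [ij|ji|->]; last exact: ltnn.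
  exact: inc2.
by apply/negbTE; rewrite -leqNgt ltnW // inc2.
Qed.

Lemma count_wperm n (pi : 'S_n.+1) K :
  count (fun w => wperm n.+1 w == pi) (words K n.+1) =
  count_desc (downto (descent (pi^-1)%g) n) K.
Proof.
rewrite (eq_in_count (a2 := fun w => descending (downto (descent (pi^-1)%g) n)
    (perm_word (pi^-1)%g w))); last by move=> w /size_word; apply: wperm_descending.
rewrite (count_perm_word _ _ (descending _)) -(count_descE _ (leqnn K)) size_downto.
rewrite -sum1_count big_mkcond; apply: eq_big_seq => -[/size_word//|c g].
by rewrite mem_words => /andP[_ /andP[-> _]] /=; case: ifP.
Qed.

End CountWords.

(** * Generating functions of descending words *)

Section CountSeries.
Variable R : comUnitRingType.
Hypothesis unit2 : (2%:R : R) \is a GRing.unit.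
Local Notation t := (fpsX : {fps R}).
Implicit Types ds : seq bool.

Definition even_series ds : {fps R} := FPS (fun k => (count_desc ds k.*2)%:R).
Definition odd_series ds : {fps R} := FPS (fun k => (count_desc ds k.*2.-1)%:R).

Lemma unit_1DX : (1 + t) \is a GRing.unit.
Proof. by rewrite fps_unitE fpsDE /= addr0 unitr1. Qed.

Lemma unit_1BX : (1 - t) \is a GRing.unit.
Proof. by rewrite fps_unitE fpsDE fpsNE /= subr0 unitr1. Qed.

Definition fps_r : {fps R} := (1 + t) / (1 - t).
Definition fps_u : {fps R} := 4%:R * t / (1 + t) ^+ 2.

(** Settles the constant terms, also for [odd_series], where the index [0.*2.-1] is truncated to
    0. *)
Lemma count_desc0 ds : count_desc ds 0 = 0%N.
Proof. by case: ds => [|d ds] //=; rewrite big_geq. Qed.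

Lemma count_desc_consS d ds k :
  count_desc (d :: ds) k.+1 = (count_desc (d :: ds) k + count_desc ds (k + (odd k (+) d)))%N.
Proof. by rewrite /= big_nat_recr. Qed.

Lemma coef_1BXM (f : {fps R}) n : ((1 - t) * f) n.+1 = f n.+1 - f n.
Proof. by rewrite mulrBl mul1r fpsDE fpsNE coef_fpsXM. Qed.

Lemma coef_1DXM (f : {fps R}) n : ((1 + t) * f) n.+1 = f n.+1 + f n.
Proof. by rewrite mulrDl mul1r fpsDE coef_fpsXM. Qed.

Lemma even_seriesE ds k : even_series ds k = (count_desc ds k.*2)%:R.
Proof. by []. Qed.

Lemma odd_seriesE ds k : odd_series ds k = (count_desc ds k.*2.-1)%:R.
Proof. by []. Qed.

(** From [k] to [k.+1] the first letter gains the values [k.*2] and [k.*2.+1]. At an ascent these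
    bound the rest by [k.*2] and [k.*2.+2]; at a descent, in the next lemma, both bound it by
    [k.*2.+1]. *)
Lemma even_series_asc ds : (1 - t) * even_series (false :: ds) = (1 + t) * even_series ds.
Proof.
apply: fpsP => -[|k]; first by rewrite !fpsM0 !even_seriesE !count_desc0 !mulr0.
rewrite coef_1BXM coef_1DXM !even_seriesE doubleS !count_desc_consS /= odd_double /=.
by rewrite addn0 addn1 !natrD; ring.
Qed.

Lemma even_series_desc ds : (1 - t) * even_series (true :: ds) = 2%:R * odd_series ds.
Proof.
apply: fpsP => -[|k].
  by rewrite !fpsM0 even_seriesE odd_seriesE !count_desc0 !mulr0.
rewrite coef_1BXM mulr_natl mulr2n fpsDE !even_seriesE odd_seriesE doubleS.
by rewrite !count_desc_consS /= odd_double /= addn0 addn1 !natrD; ring.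
Qed.

(** The bounds [k.*2.+2] and [k.*2.+1] differ by the words with first letter [k.*2.+1]. *)
Lemma odd_series_asc ds : odd_series (false :: ds) = even_series (false :: ds) - even_series ds.
Proof.
apply: fpsP => -[|k]; rewrite fpsDE fpsNE !even_seriesE odd_seriesE.
  by rewrite !count_desc0 subr0.
rewrite doubleS [k.*2.+2.-1]/= [in X in X - _]count_desc_consS /= odd_double /=.
by rewrite addn1 natrD addrK.
Qed.

Lemma odd_series_desc ds : odd_series (true :: ds) = even_series (true :: ds) - odd_series ds.
Proof.
apply: fpsP => -[|k]; rewrite fpsDE fpsNE !even_seriesE !odd_seriesE.
  by rewrite !count_desc0 subr0.
rewrite doubleS [k.*2.+2.-1]/= [in X in X - _]count_desc_consS /= odd_double /=.
by rewrite addn0 natrD addrK.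
Qed.

Lemma even_series_nil : (1 - t) ^+ 2 * even_series [::] = 2%:R * t.
Proof.
rewrite expr2 -mulrA; apply: fpsP => -[|k].
  by rewrite !fpsM0 /= !mulr0.
rewrite coef_1BXM [2%:R * t]mulrC coef_fpsXM.
have E n : ((1 - t) * even_series [::]) n = if n is m.+1 then 2%:R else 0.
  case: n => [|n]; first by rewrite fpsM0 mulr0.
  rewrite coef_1BXM !even_seriesE /= doubleS -addn2 natrD; ring.
rewrite !E; case: k => [|k]; first by rewrite subr0 fps_coef0_nat.
by rewrite subrr -[2%:R]/(1 + 1) fpsDE /= addr0.
Qed.

Lemma odd_series_nil : 2%:R * odd_series [::] = (1 + t) * even_series [::].
Proof.
apply: fpsP => -[|k]; first by rewrite !fpsM0 /= !mulr0.
rewrite coef_1DXM mulr_natl mulr2n fpsDE odd_seriesE !even_seriesE doubleS /=.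
by rewrite -addn2 -addn1 !natrD; ring.
Qed.

(* [even_series] and [odd_series] count the words with letters up to k and up to
   k' respectively; their ratio depends only on whether the last step was a
   descent, and only an ascent followed by a descent contributes [fps_u]. *)
Lemma even_odd_series ds :
  2%:R * even_series ds = fps_r ^+ (size ds).+2 * fps_u ^+ (peaks ds).+1 /\
  if head true ds then 2%:R * odd_series ds = (1 + t) * even_series ds
  else (1 + t) * odd_series ds = 2%:R * t * even_series ds.
Proof.
have [uD uB] := (unit_1DX, unit_1BX).
have rE : (1 - t) * fps_r = 1 + t by rewrite mulrC divrK.
have uE : (1 + t) ^+ 2 * fps_u = 4%:R * t by rewrite mulrC divrK ?unitrX.
elim: ds => [|d ds [IHeven IHodd]] /=.
  split; last exact: odd_series_nil.
  apply: (mulrI (unitrX 2 uB)); rewrite mulrCA even_series_nil.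
  by rewrite expr1 [RHS]mulrA -exprMn rE uE; ring.
case: d => /=; last first.
  split; last first.
    rewrite odd_series_asc mulrBr -(even_series_asc ds); ring.
  apply: (mulrI uB); rewrite mulrCA even_series_asc mulrCA IHeven.
  by rewrite -[in LHS]rE add0n !exprS; ring.
move: IHodd; case: (head true ds) => /= IHodd.
  (* The list ends or continues with a descent: no new peak, and the step multiplies by [fps_r] just
     as an ascent does. *)
  have E : (1 - t) * even_series (true :: ds) = (1 + t) * even_series ds.
    by rewrite even_series_desc.
  split; last by rewrite odd_series_desc mulrBr IHodd -E; ring.
  apply: (mulrI uB); rewrite mulrCA E mulrCA IHeven.
  by rewrite -[in LHS]rE add0n !exprS; ring.
(* An ascent comes next in the list, so there is a new peak; [fps_u] arises from
   [4%:R * t = (1 + t) ^+ 2 * fps_u]. *)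
have E : (1 - t) * even_series (true :: ds) = (1 - t) * (fps_r * fps_u * even_series ds).
  apply: (mulrI uD); rewrite even_series_desc mulrCA IHodd.
  rewrite [RHS](_ : _ = (1 + t) * ((1 - t) * fps_r) * fps_u * even_series ds); last by ring.
  by rewrite rE -expr2 uE; ring.
split; first by rewrite (mulrI uB E) mulrCA IHeven add1n !exprS; ring.
rewrite odd_series_desc mulrBr -even_series_desc; ring.
Qed.

(** The first factor is half of [fps_r], which accounts for the 2 and for one power in
    [even_odd_series]. *)
Lemma coef_ru ds k :
  ((1 + t) / (2%:R * (1 - t)) * fps_r ^+ (size ds).+1 * fps_u ^+ (peaks ds).+1) k =
  (count_desc ds k.*2)%:R.
Proof.
have u2 : (2%:R : {fps R}) \is a GRing.unit by rewrite fps_unitE fps_coef0_nat.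
have cE : 2%:R * ((1 + t) / (2%:R * (1 - t))) = fps_r.
  by rewrite /fps_r invrM ?unit_1BX // mulrCA [_^-1 * _]mulrC mulVKr.
rewrite -even_seriesE; congr (fps_coef _ _); apply: (mulrI u2).
rewrite (even_odd_series ds).1; set c := _ / _ in cE *.
by rewrite -cE !exprS; ring.
Qed.

End CountSeries.

(** * The identity *)

Section WordRecurrence.
Variables (Gamma : permset) (R : comNzRingType) (y : R).
Hypothesis Gamma_ge2 : forall (m : nat) (sigma : 'S_m), sigma \in Gamma m -> (2 <= m)%N.
Implicit Types (w : seq nat) (K n : nat).

(** A single letter is a block although it carries no cluster, hence the separate value 1. *)
Definition cluster_weight n w : R :=
  if n == 1%N then 1 else \sum_(c in clusters Gamma (wperm n w)) y ^+ mk c.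

Lemma occ_sub_gf N n w : size w = n -> (n <= N)%N ->
  (1 + y) ^+ occ Gamma (wperm n w) =
  sub_gf y (intervals_in (marked_factors Gamma N w) 0 n) xpredT.
Proof.
move=> sw le_nN; rewrite (occ_wperm Gamma_ge2 sw le_nN) -sum_subsets.
by apply: eq_bigl => S; rewrite andbT.
Qed.

Lemma cluster_weight_sub_gf N n w : size w = n -> (0 < n <= N)%N ->
  cluster_weight n w =
  sub_gf y (intervals_in (marked_factors Gamma N w) 0 n) (covering n).
Proof.
move=> sw /andP[n_gt0 le_nN]; rewrite /cluster_weight /sub_gf; case: eqVneq => [n1|n_neq1].
  (* No pattern fits into one letter; the empty set remains and covers vacuously. *)
  rewrite (_ : intervals_in _ 0 n = finset.set0) => [|]; last first.
    apply/setP => -[a b]; rewrite !inE /=; apply/negP => /andP[/Gamma_ge2].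
    by rewrite n1; lia.
  rewrite (big_pred1 finset.set0) ?cards0 // => S /=.
  rewrite subset0; apply: andb_idr => /eqP ->; apply/coveringP => g; rewrite n1; lia.
have n_gt1 : (1 < n)%N by lia.
rewrite -(span_of_marked_occs Gamma_ge2 sw le_nN).
rewrite (sum_subsets_imset _ (P := fun S => covering n [set span_of N p | p in S])) //.
  by apply: eq_bigl => S; rewrite (clusters_wperm Gamma_ge2 sw le_nN).
exact: span_of_inj.
Qed.

(** Expand the power of [1 + y] over all sets of marks and split at the first cut. The letters on
    its two sides vary independently, which gives a product. *)
Lemma occ_words_rec K n :
  \sum_(w <- words K n.+1) (1 + y) ^+ occ Gamma (wperm n.+1 w) =
  \sum_(j < n.+1) (\sum_(u <- words K j.+1) cluster_weight j.+1 u) *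
    (\sum_(v <- words K (n - j)) (1 + y) ^+ occ Gamma (wperm (n - j) v)).
Proof.
rewrite big_seq; under eq_bigr => w /size_word sw.
  rewrite (occ_sub_gf sw (leqnn _)) sub_gf_first_block //; over.
rewrite -big_seq exchange_big; apply: eq_bigr => j _.
have j_le : (j <= n)%N by rewrite -ltnS.
have nE : n.+1 = (j.+1 + (n - j))%N by rewrite addSn subnKC.
have -> : words K n.+1 = words K (j.+1 + (n - j)) by rewrite -nE.
rewrite big_words_cat mulr_suml; apply: eq_big_seq => u /size_word su.
rewrite mulr_sumr; apply: eq_big_seq => v /size_word sv.
rewrite (@cluster_weight_sub_gf n.+1) //.
rewrite (@occ_sub_gf n.+1) //; last by lia.
have -> : intervals_in (marked_factors Gamma n.+1 (u ++ v)) 0 j.+1 =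
    intervals_in (marked_factors Gamma n.+1 u) 0 j.+1.
  by rewrite -su marked_factors_catl.
(* Sums over unrestricted sets are powers of [1 + y], so only the numbers of intervals have to
   agree. *)
congr (_ * _); rewrite /sub_gf; under eq_bigl do rewrite andbT.
under [RHS]eq_bigl do rewrite andbT.
rewrite !sum_subsets; congr (_ ^+ _).
have := @card_marked_factors_catr Gamma n.+1 u v; rewrite su sv -nE; exact.
Qed.

End WordRecurrence.

(** * Extraction of coefficients in t *)

Section CoefficientInT.
Variable R : comUnitRingType.

Lemma geometric_series k : ((1 - fpsX : {fps R})^-1) k = 1.
Proof.
have E : (1 - fpsX) * FPS (fun=> 1 : R) = 1.
  apply: fpsP => -[|n]; first by rewrite fpsM0 mulr1 fpsDE fpsNE /= subr0.
  by rewrite coef_1BXM /= subrr.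
have -> // : (1 - fpsX : {fps R})^-1 = FPS (fun=> 1).
by apply: (mulrI (@unit_1BX R)); rewrite mulrV ?unit_1BX.
Qed.

Definition coef_t k (f : {fps {fps R}}) : {fps R} := FPS (fun n => f n k).

(** For fixed [k], [hadamard] is the Cauchy product in x, and its unit [1 / (1 - t)] has all
    coefficients 1. *)
Lemma coef_t_hadamard_pow k (f : {fps {fps R}}) n :
  coef_t k (hadamard_pow f n) = coef_t k f ^+ n.
Proof.
elim: n => [|n IHn].
  apply: fpsP => m; rewrite expr0 /= /hadamard_pow /=.
  rewrite -[1 : {fps {fps R}}]/(fpsC 1) -rmorphB -rmorphV ?unit_1BX //.
rewrite fpsCE; case: m => [|m] //; exact: geometric_series.
rewrite exprS -IHn; exact: fpsP.
Qed.

Lemma coef_t_hadamard_sum k (f : {fps {fps R}}) : fps_order_ge 1 f ->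
  coef_t k (fps_sum 0 (hadamard_pow f)) = fps_sum 0 (fun n => coef_t k f ^+ n).
Proof.
move=> f1; apply: fpsP => n; have f1k : fps_order_ge 1 (coef_t k f).
  by move=> i /f1 /= ->.
rewrite -[LHS]/(fps_sum 0 (hadamard_pow f) n k).
rewrite !fps_sum_coefE; last 2 first.
- by move=> m; apply: fps_order_geX.
- by move=> m; apply: order_hadamard_pow.
by rewrite fps_coef_sum; apply: eq_bigr => m _; rewrite -coef_t_hadamard_pow.
Qed.

Lemma sum_wperm n (W : seq (seq nat)) (H : 'S_n -> R) :
  \sum_(pi : 'S_n) H pi * (count (fun w => wperm n w == pi) W)%:R =
  \sum_(w <- W) H (wperm n w).
Proof.
elim: W => [|w W IHW]; first by rewrite big_nil big1 // => pi _; rewrite mulr0.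
rewrite big_cons -IHW (bigD1 (wperm n w)) //= [in RHS](bigD1 (wperm n w)) //= addrA.
rewrite eqxx natrD mulrDr mulr1; congr (_ + _); apply: eq_bigr => pi.
by rewrite eq_sym => /negbTE ->.
Qed.

End CoefficientInT.

Local Notation R := {fps rat}.
Local Notation s0 := (fpsX : R).
Local Notation tau := (fpsX : {fps R}).
Local Notation prefactor := ((1 + tau) / (2%:R * (1 - tau))).
Local Notation rt := (fps_r R).
Local Notation ut := (fps_u R).

Lemma unit2_fps : (2%:R : R) \is a GRing.unit.
Proof. by rewrite fps_unitE fps_coef0_nat. Qed.

Lemma unit_2_1BX : (2%:R * (1 - tau) : {fps R}) \is a GRing.unit.
Proof. by rewrite unitrM unit_1BX andbT fps_unitE fps_coef0_nat unit2_fps. Qed.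

Lemma var_t1D : 1 + var_t = fpsC (1 + tau).
Proof. by rewrite rmorphD rmorph1. Qed.

Lemma var_t1B : 1 - var_t = fpsC (1 - tau).
Proof. by rewrite rmorphB rmorph1. Qed.

Lemma ser_uE : ser_u = fpsC ut.
Proof.
rewrite /ser_u var_t1D /ut -rmorphXn /= -rmorphV ?unitrX ?unit_1DX //.
by rewrite [in RHS]rmorphM /= [in RHS]rmorphM /= rmorph_nat.
Qed.

Lemma ser_zE : ser_z = fpsC rt * fpsX.
Proof.
rewrite /ser_z var_t1D var_t1B -rmorphV ?unit_1BX // mulrAC.
by rewrite /rt [in RHS]rmorphM.
Qed.

Lemma prefactorE : (1 + var_t) / (2%:R * (1 - var_t)) = fpsC prefactor.
Proof.
rewrite var_t1D var_t1B -[2%:R]/(2%:R : series) -(rmorph_nat (@fpsC {fps R})).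
by rewrite -rmorphM -rmorphV ?unit_2_1BX // -rmorphM.
Qed.

Lemma coef_fpsC_ser_z (p : {fps R}) m n :
  (fpsC p * ser_z ^+ m) n = if n == m then p * rt ^+ m else 0.
Proof. by rewrite ser_zE exprMn -rmorphXn mulrA -rmorphM coef_fpsCXn. Qed.

Lemma coef_fps_sum_ser_z a (P : nat -> {fps R}) n :
  fps_sum a (fun m => fpsC (P m) * ser_z ^+ m) n =
  if (a <= n)%N then P n * rt ^+ n else 0.
Proof.
rewrite fps_sum_coefE; last by move=> m; apply: order_term.
under eq_bigr => m _ do rewrite coef_fpsC_ser_z.
case: ifPn => [le_an|]; last by rewrite -ltnNge => lt_na; rewrite big_geq.
rewrite big_nat_recr //= eqxx big_nat_cond big1 ?add0r // => m.
by move=> /andP[/andP[_ m_lt] _]; rewrite gtn_eqF.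
Qed.

(** The descents of [pi^-1] govern the words with standardization [pi], so the peaks in [coef_ru]
    become [ipk pi]. *)
Lemma coef_weight n (pi : 'S_n.+1) (a : R) k :
  (prefactor * (fpsC a * ut ^+ (ipk pi).+1 * rt ^+ n.+1)) k =
  a * (count (fun w => wperm n.+1 w == pi) (words k.*2 n.+1))%:R.
Proof.
rewrite (_ : _ * _ = fpsC a * (prefactor * rt ^+ n.+1 * ut ^+ (ipk pi).+1)); last by ring.
rewrite coef_fpsCM count_wperm -(coef_ru unit2_fps) size_downto.
by rewrite /ipk peaks_descents.
Qed.

Lemma Pipk_fpsC Gamma n :
  Pipk Gamma n var_s ser_u = fpsC (Pipk Gamma n (fpsC s0) ut).
Proof.
rewrite rmorph_sum; apply: eq_bigr => pi _.
by rewrite rmorphM !rmorphXn ser_uE.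
Qed.

Lemma Ripk_fpsC Gamma n :
  Ripk Gamma n (var_s - 1) ser_u = fpsC (Ripk Gamma n (fpsC (s0 - 1)) ut).
Proof.
rewrite rmorph_sum; apply: eq_bigr => pi _.
rewrite rmorphM rmorphXn ser_uE rmorph_sum; congr (_ * _); apply: eq_bigr => c _.
by rewrite rmorphXn /= !rmorphB !rmorph1.
Qed.

Section Coefficients.
Variable Gamma : permset.
Hypothesis Gamma_ge2 : forall (m : nat) (sigma : 'S_m), sigma \in Gamma m -> (2 <= m)%N.

Lemma coef_Pipk n k :
  (prefactor * (Pipk Gamma n.+1 (fpsC s0) ut * rt ^+ n.+1)) k =
  \sum_(w <- words k.*2 n.+1) s0 ^+ occ Gamma (wperm n.+1 w).
Proof.
rewrite -(sum_wperm _ (fun pi => s0 ^+ occ Gamma pi)) mulr_suml mulr_sumr fps_coef_sum.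
by apply: eq_bigr => pi _; rewrite -rmorphXn coef_weight.
Qed.

Lemma coef_Ripk n k :
  (prefactor * (Ripk Gamma n.+2 (fpsC (s0 - 1)) ut * rt ^+ n.+2)) k =
  \sum_(w <- words k.*2 n.+2) cluster_weight Gamma (s0 - 1) n.+2 w.
Proof.
rewrite -(sum_wperm _ (fun pi => \sum_(c in clusters Gamma pi) (s0 - 1) ^+ mk c)).
rewrite mulr_suml mulr_sumr fps_coef_sum; apply: eq_bigr => pi _.
rewrite (_ : \sum_(c in clusters Gamma pi) fpsC (s0 - 1) ^+ mk c =
    fpsC (\sum_(c in clusters Gamma pi) (s0 - 1) ^+ mk c)).
  by rewrite [ut ^+ _ * _]mulrC coef_weight.
by rewrite rmorph_sum; apply: eq_bigr => c _; rewrite rmorphXn.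
Qed.

(** [even_series [::]] counts one-letter words, so this term supplies the blocks of length 1. *)
Lemma linear_termE : 2%:R * var_t * var_x / (1 - var_t) ^+ 2 =
  fpsC (even_series R [::]) * fpsX.
Proof.
have -> : even_series R [::] = 2%:R * tau / (1 - tau) ^+ 2.
  by rewrite -even_series_nil mulrAC mulrV ?mul1r // unitrX ?unit_1BX.
have V : fpsC ((1 - tau) ^+ 2)^-1 = ((1 - var_t) ^+ 2)^-1.
  by rewrite rmorphV ?unitrX ?unit_1BX // rmorphXn var_t1B.
rewrite [LHS]mulrAC -V.
have two : fpsC (2%:R : {fps R}) = 2%:R := rmorph_nat _ 2.
by rewrite !fpsCM two.
Qed.

Lemma coef_t_cluster_series k n : coef_t k (cluster_series Gamma) n =
  if n is 0%N then 0
  else \sum_(w <- words k.*2 n) cluster_weight Gamma (s0 - 1) n w.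
Proof.
rewrite -[LHS]/(cluster_series Gamma n k) /cluster_series linear_termE prefactorE.
rewrite fpsDE !coef_fpsCM.
have -> : (fun m => Ripk Gamma m (var_s - 1) ser_u * ser_z ^+ m) =
    (fun m => fpsC (Ripk Gamma m (fpsC (s0 - 1)) ut) * ser_z ^+ m).
  by apply: funext => m; rewrite Ripk_fpsC.
rewrite coef_fps_sum_ser_z; case: n => [|[|n]].
- by rewrite !mulr0 addr0.
- rewrite mulr1 mulr0 addr0 even_seriesE big_wordsS.
  under eq_bigr do rewrite big_seq1.
  by rewrite sumr_const_nat subn0.
- by rewrite mulr0 add0r coef_Ripk.
Qed.

(** Only a pattern of length 0 could occur here, and the length bound on [Gamma] excludes it. *)
Lemma occ_S0 (pi : 'S_0) : occ Gamma pi = 0%N.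
Proof.
apply/eqP; rewrite cards_eq0; apply/eqP/setP => p; rewrite !inE.
by apply/negP => /andP[/Gamma_ge2 len2 /andP[/andP[]]]; lia.
Qed.

(** The summand [1 / (1 - t)] counts the empty word once for each [k]. *)
Lemma coef_t_occurrence_series k n :
  coef_t k (1 / (1 - var_t) + (1 + var_t) / (2%:R * (1 - var_t)) *
    fps_sum 1 (fun m => Pipk Gamma m var_s ser_u * ser_z ^+ m)) n =
  \sum_(w <- words k.*2 n) s0 ^+ occ Gamma (wperm n w).
Proof.
rewrite -[LHS]/((_ : series) n k) prefactorE var_t1B div1r -rmorphV ?unit_1BX //.
rewrite fpsDE coef_fpsCM fpsCE.
have -> : (fun m => Pipk Gamma m var_s ser_u * ser_z ^+ m) =
    (fun m => fpsC (Pipk Gamma m (fpsC s0) ut) * ser_z ^+ m).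
  by apply: funext => m; rewrite Pipk_fpsC.
rewrite coef_fps_sum_ser_z; case: n => [|n].
  by rewrite mulr0 addr0 geometric_series big_seq1 occ_S0.
by rewrite add0r coef_Pipk.
Qed.

(* Abstract [F] and [C] keep unification from unfolding the actual series. *)
Lemma series_of_clusters (F C : {fps {fps R}}) :
  (forall k n, coef_t k F n = \sum_(w <- words k.*2 n) s0 ^+ occ Gamma (wperm n w)) ->
  (forall k n, coef_t k C n = if n is 0%N then 0
    else \sum_(w <- words k.*2 n) cluster_weight Gamma (s0 - 1) n w) ->
  fps_order_ge 1 C -> F = fps_sum 0 (hadamard_pow C).
Proof.
move=> FE CE C1; suff E k : coef_t k F = fps_sum 0 (fun n => coef_t k C ^+ n).
  apply: fpsP => n; apply: fpsP => k; have := E k; rewrite -coef_t_hadamard_sum //.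
  by move/(congr1 (fun f => fps_coef f n)).
apply: geometric_fps_sum => [i lti1|].
  by rewrite -[LHS]/(C i k) C1.
apply: fpsP => n; rewrite FE fpsDE fpsME big_ord_recl CE mul0r add0r.
case: n => [|n]; first by rewrite big_ord0 big_seq1 occ_S0 addr0.
rewrite add0r.
(* With [y = s0 - 1] the weight [1 + y] is [s0]. The vanishing constant term of [C] has shifted the
   Cauchy product to blocks of length [j.+1]. *)
have := @occ_words_rec Gamma _ (s0 - 1) Gamma_ge2 k.*2 n; rewrite addrC subrK => ->.
by apply: eq_bigr => j _; rewrite CE FE.
Qed.

End Coefficients.

Theorem theorem3p9 (Gamma : permset)
    (Gamma_ge2 : forall (m : nat) (sigma : 'S_m), sigma \in Gamma m -> (2 <= m)%N) :
  let s := var_s in let t := var_t in let x := var_x in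
  let u := 4%:R * t / (1 + t) ^+ 2 in
  let z := (1 + t) * x / (1 - t) in
  1 / (1 - t)
    + (1 + t) / (2%:R * (1 - t))
      * fps_sum 1 (fun n => Pipk Gamma n s u * z ^+ n)
  = fps_sum 0 (fun n => hadamard_pow
      (2%:R * t * x / (1 - t) ^+ 2
       + (1 + t) / (2%:R * (1 - t))
         * fps_sum 2 (fun k => Ripk Gamma k (s - 1) u * z ^+ k)) n).
Proof.
move=> s t x u z.
refine (series_of_clusters Gamma_ge2 (coef_t_occurrence_series Gamma_ge2)
  (coef_t_cluster_series Gamma) (@order_cluster_series Gamma)).
Qed.
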